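(* Let $D=(d_1,d_2,\dots,d_n)$ be a nonincreasing sequence of positive integers with $d_1<n$ and let $i\in[1..n]$. Put $\widetilde{d_i}=d_i$ if $d_i<i$ and $\widetilde{d_i}=d_i+1$ if $d_i\ge i$. Let $j\in[1..n]\setminus\{i\}$ be such that at least one of the following holds: (1) $d_j=d_{\widetilde{d_i}}$ (the integer of $D$ with index $\widetilde{d_i}$); (2) $d_j=d_{\widetilde{d_i}}+1$; (3) $d_i\ge d_k$ for all $k\in[1..n]$, and $j>d_i+1$. Then $D$ is graphic if and only if the sequence $D^{<i,j>}$ obtained by applying the 2-reduction $<i,j>$ to $D$ is graphic.
   Context: $[a..b]$ denotes the set of integers $k$ with $a\le k\le b$. A finite sequence of positive integers is graphic if it is the degree sequence of a simple graph (no loops, no multiple edges); the empty sequence is considered graphic. For $i\ne j$ in $[1..n]$, the 2-reduction $<i,j>$ of $D=(d_1,\dots,d_n)$ subtracts 1 from $d_i$ and 1 from $d_j$; the resulting sequence, after being reordered in nonincreasing order and after removal of all zeros, is denoted $D^{<i,j>}$. *)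

(* Defs.v *)
From mathcomp Require Import all_boot.

Set Implicit Arguments.
Unset Strict Implicit.
Unset Printing Implicit Defensive.

(** Sequences are indexed from 1, since indices are compared with terms:
    [term D k] is d_k for 1 <= k <= size D (and a junk value elsewhere). *)
Definition term (D : seq nat) (k : nat) : nat := nth 0 D k.-1.

Definition degree (T : finType) (e : rel T) (v : T) : nat :=
  #|[set w | e v w]|.

(** The vertices of the realizing graph are labelled so that the k-th vertex
    has degree d_k; relabelling makes the order of the terms immaterial. *)
Definition graphic (D : seq nat) : Prop :=
  exists e : rel 'I_(size D),
    [/\ symmetric e, irreflexive e
      & D = [seq degree e v | v <- enum 'I_(size D)]].

(** The sequence D^<i,j>; the booleans [k == i] and [k == j] are read as 0 or 1. *)
Definition two_reduction (D : seq nat) (i j : nat) : seq nat :=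
  [seq x <- sort geq [seq term D k - (k == i) - (k == j) | k <- iota 1 (size D)]
     | x != 0].

Definition tilde (D : seq nat) (i : nat) : nat :=
  if term D i < i then term D i else (term D i).+1.

(* Main.v *)
(* Realizations of D in which ij is an edge correspond, by deleting ij, to
   realizations of the reduced sequence in which ij is not an edge.  If a is
   adjacent to b but not to c, and c has degree at least that of b, then one can
   switch edges so as to make a adjacent to c instead of b, without changing any
   degree.  Starting from a realization of D where ij is not an edge, such a
   switch at i creates it, trading a neighbour k of i with d_k <= d_j for j (in
   case (3), a switch at j, trading any neighbour of j for i).  Starting from a
   realization of the reduced sequence where ij is an edge, i has lost a
   neighbour, so it misses some vertex k among the d_i first ones other than i,
   and a switch at i trades j for k. *)
Require Import Defs.
From mathcomp Require Import all_boot.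
From mathcomp Require Import zify.

Set Implicit Arguments.
Unset Strict Implicit.
Unset Printing Implicit Defensive.

(** Degrees are prescribed vertex by vertex and may be 0, so the reduced degrees live on the
    original vertex set, before sorting and removal of zeros. *)
Definition realizes (T : finType) (e : rel T) (d : T -> nat) : Prop :=
  [/\ symmetric e, irreflexive e & degree e =1 d].

(** * Adding, deleting and switching edges *)

Section EdgeFlips.
Variable T : finType.
Implicit Types (e : rel T) (d : T -> nat) (a b c u v x y : T).

(** Exclusive or lets one operation both add and delete [xy]; being an involution, it yields the
    degrees after an addition from those after a deletion. *)
Definition flip_edge e x y : rel T :=
  fun u v => e u v (+) ((u == x) && (v == y) || (u == y) && (v == x)).

Lemma flip_edgeE e x y u v :
  flip_edge e x y u v =
  e u v (+) ((u == x) && (v == y) || (u == y) && (v == x)).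
Proof. by []. Qed.

Lemma flip_edge_sym e x y : symmetric e -> symmetric (flip_edge e x y).
Proof.
by move=> esym u v; rewrite !flip_edgeE esym orbC andbC [(u == x) && _]andbC.
Qed.

Lemma flip_edge_irr e x y :
  x != y -> irreflexive e -> irreflexive (flip_edge e x y).
Proof.
move=> nxy eirr u; rewrite flip_edgeE eirr andbC orbb /=.
by apply: contraNF nxy => /andP[/eqP<- /eqP<-].
Qed.

Lemma degree_del_edge e x y v : symmetric e -> x != y -> e x y ->
  degree e v = degree (flip_edge e x y) v + ((v == x) + (v == y)).
Proof.
move=> esym nxy exy; rewrite /degree.
have flipE z w : e z w ->
    #|[set t | e z t]| = #|[set t | e z t (+) (t == w)]| + 1.
  move=> ezw; rewrite (cardsD1 w) inE ezw addnC; congr (_ + _).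
  apply: eq_card => t; rewrite !inE.
  by case: eqP => [->|_]; rewrite ?ezw ?addbF.
have [->|nvx] := eqVneq v x.
  rewrite (negbTE nxy) (flipE x y) // addn0; congr (_ + _).
  by apply: eq_card => t; rewrite !inE flip_edgeE eqxx (negbTE nxy) orbF.
have [->|nvy] := eqVneq v y.
  rewrite (flipE y x) 1?esym //; congr (_ + _).
  by apply: eq_card => t; rewrite !inE flip_edgeE eqxx (eq_sym y) (negbTE nxy).
rewrite !addn0; apply: eq_card => t.
by rewrite !inE flip_edgeE (negbTE nvx) (negbTE nvy) addbF.
Qed.

Lemma degree_add_edge e x y v : symmetric e -> x != y -> ~~ e x y ->
  degree (flip_edge e x y) v = degree e v + ((v == x) + (v == y)).
Proof.
move=> esym nxy nexy; rewrite (degree_del_edge v (flip_edge_sym x y esym) nxy).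
  congr (_ + _); apply: eq_card => t.
  by rewrite !inE !flip_edgeE -addbA addbb addbF.
by rewrite flip_edgeE !eqxx (negbTE nexy).
Qed.

(* Replaces the edges ab, cu by ac, bu, where u is a neighbour of c but not
   of b; such a u exists because a is a neighbour of b but not of c. *)
Lemma switch e d a b c : realizes e d -> e a b -> ~~ e a c -> a != c ->
  d b <= d c -> exists e', [/\ realizes e' d, ~~ e' a b & e' a c].
Proof.
move=> [esym eirr edeg] eab neac nac; rewrite -!edeg => dbc.
have nab : a != b by apply: contraTneq eab => ->; rewrite eirr.
have nbc : b != c by apply: contraTneq eab => ->.
(* Otherwise the neighbours of [c] other than [b] would be among those of [b] other than [c],
   properly because of [a], so [c] would have smaller degree than [b]. *)
have [u /andP[ecu neu] nub] : exists2 u, e c u && ~~ e b u & u != b.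
  have /subsetPn[u] : ~~ ([set u | e c u] :\ b \subset [set u | e b u] :\ c).
    apply: contraTN dbc => sub; rewrite -ltnNge /degree.
    rewrite (cardsD1 b) (cardsD1 c [set u | e b u]) !inE esym ltn_add2l.
    apply: proper_card; rewrite properE sub /=; apply/subsetPn; exists a.
      by rewrite !inE nac esym.
    by rewrite !inE nab esym.
  rewrite !inE => /andP[nub ecu]; rewrite negb_and negbK => /orP[/eqP uc|neu].
    by move: ecu; rewrite uc eirr.
  by exists u => //; rewrite ecu.
have nuc : u != c by apply: contraTneq ecu => ->; rewrite eirr.
have nua : u != a by apply: contraTneq ecu => ->; rewrite esym.
(* The four pairs are distinct, so each flip finds its pair as it was in [e]; each of [a], [b], [c],
   [u] loses one edge and gains one. *)
pose e1 := flip_edge e a b; pose e2 := flip_edge e1 a c.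
pose e3 := flip_edge e2 c u; pose e4 := flip_edge e3 b u.
have neqs := (negbTE nab, negbTE nac, negbTE nbc, negbTE nua, negbTE nub,
  negbTE nuc, eq_sym b a, eq_sym c a, eq_sym c b, eq_sym a u, eq_sym b u,
  eq_sym c u, eqxx).
have s1 : symmetric e1 by apply: flip_edge_sym.
have s2 : symmetric e2 by apply: flip_edge_sym.
have s3 : symmetric e3 by apply: flip_edge_sym.
have e1ac : ~~ e1 a c by rewrite /e1 !flip_edgeE !neqs addbF.
have e2cu : e2 c u by rewrite /e2 /e1 !flip_edgeE !neqs !addbF.
have e3bu : ~~ e3 b u by rewrite /e3 /e2 /e1 !flip_edgeE !neqs !addbF.
have ncu : c != u by rewrite eq_sym.
have nbu : b != u by rewrite eq_sym.
exists e4; split; last 2 first.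
- by rewrite /e4 /e3 /e2 /e1 !flip_edgeE !neqs eab.
- by rewrite /e4 /e3 /e2 /e1 !flip_edgeE !neqs (negbTE neac).
split; first exact: flip_edge_sym.
  by do 4!apply: flip_edge_irr => //.
move=> v; rewrite -edeg.
have := degree_add_edge v s3 nbu e3bu.
have := degree_del_edge v s2 ncu e2cu.
have := degree_add_edge v s1 nac e1ac.
have := degree_del_edge v esym nab eab.
rewrite -/e1 -/e2 -/e3 -/e4.
move: (degree e v) (degree e1 v) (degree e2 v) (degree e3 v) (degree e4 v).
move: (v == a : nat) (v == b : nat) (v == c : nat) (v == u : nat).
by clear; lia.
Qed.

Lemma realizes_del_edge e d a b : realizes e d -> e a b ->
  realizes (flip_edge e a b) (fun v => d v - (v == a) - (v == b)).
Proof.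
move=> [esym eirr edeg] eab.
have nab : a != b by apply: contraTneq eab => ->; rewrite eirr.
split; [exact: flip_edge_sym | exact: flip_edge_irr | move=> v].
rewrite -edeg (degree_del_edge v esym nab eab); lia.
Qed.

(** Positivity ensures that the truncated subtractions really take 1 away. *)
Lemma realizes_add_edge e d a b : 0 < d a -> 0 < d b -> a != b ->
  realizes e (fun v => d v - (v == a) - (v == b)) -> ~~ e a b ->
  realizes (flip_edge e a b) d.
Proof.
move=> da db nab [esym eirr edeg] neab.
split; [exact: flip_edge_sym | exact: flip_edge_irr | move=> v].
rewrite (degree_add_edge v esym nab neab) edeg.
have [->|_] := eqVneq v a; first by rewrite (negbTE nab); lia.
by have [->|_] := eqVneq v b; lia.
Qed.

End EdgeFlips.

(** * Relabelling and isolated vertices *)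

Lemma degree_relpre (S T : finType) (f : S -> T) (e : rel T) (k : S) :
  injective f -> (forall w, e (f k) w -> w \in codom f) ->
  degree (relpre f e) k = degree e (f k).
Proof.
move=> finj sub; rewrite /degree -(card_imset _ finj).
apply: eq_card => w; rewrite inE; apply/imsetP/idP => [[l]|ew].
  by rewrite inE => el ->.
have /codomP[l wl] := sub w ew; exists l => //.
by rewrite inE /= -wl.
Qed.

(** The vertices outside the image of [f] have degree 0, so the two sides differ by isolated
    vertices only. *)
Lemma realizes_codom (S T : finType) (f : S -> T) (d : T -> nat) :
  injective f -> (forall v, (v \in codom f) = (d v != 0)) ->
  (exists e, realizes e (d \o f)) <-> (exists e, realizes e d).
Proof.
move=> finj codf; split=> [] [e [esym eirr edeg]].
  pose e' : rel T :=
    fun v w => [exists k, exists l, [&& f k == v, f l == w & e k l]].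
  have e'f : relpre f e' =2 e.
    move=> k l; apply/existsP/idP => [[k' /existsP[l' /and3P[]]]|ekl].
      by move=> /eqP/finj-> /eqP/finj->.
    by exists k; apply/existsP; exists l; rewrite !eqxx.
  have e'codom v w : e' v w -> (v \in codom f) && (w \in codom f).
    by case/existsP=> k /existsP[l /and3P[/eqP<- /eqP<- _]]; rewrite !codom_f.
  exists e'; split.
  - move=> v w; apply/existsP/existsP => -[k /existsP[l /and3P[vk wl ekl]]];
      exists l; apply/existsP; exists k; by rewrite wl vk esym.
  - move=> v; case e'vv: (e' v v) => //.
    have /andP[/codomP[k vk] _] := e'codom v v e'vv.
    by rewrite -e'vv vk; have := e'f k k; rewrite eirr /relpre.
  - move=> v; have [/codomP[k ->]|nv] := boolP (v \in codom f).
      rewrite -[RHS]/((d \o f) k) -edeg -degree_relpre //.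
        by apply: eq_card => l; rewrite !inE e'f.
      by move=> w /e'codom/andP[].
    move: (nv); rewrite codf negbK => /eqP->; apply: eq_card0 => w.
    by rewrite inE; apply: contraNF nv => /e'codom/andP[].
(* Any neighbour has positive degree, hence lies in the image: the pullback loses no edge. *)
exists (relpre f e); split=> [k l|k|k] /=; [exact: esym | exact: eirr |].
rewrite degree_relpre // => w ew; rewrite codf -edeg -lt0n.
by apply/card_gt0P; exists (f k); rewrite inE esym.
Qed.

Lemma graphicP (D : seq nat) :
  graphic D <-> exists e : rel 'I_(size D), realizes e (fun v => nth 0 D v).
Proof.
have DE : D = [seq nth 0 D (val v) | v <- enum 'I_(size D)].
  by rewrite (map_comp (nth 0 D) val) val_enum_ord -/(mkseq _ _) mkseq_nth.
split=> [] [e [esym eirr edeg]]; exists e; split=> //.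
  move: edeg; rewrite {1}DE => /eq_in_map edeg v.
  by rewrite -edeg ?mem_enum.
by rewrite {1}DE; apply: eq_map => v; rewrite edeg.
Qed.

(** This absorbs the sorting and the removal of zeros in [two_reduction]. *)
Lemma graphic_nonzero_terms (T : finType) (d : T -> nat) (s : seq nat) :
  perm_eq s [seq x <- [seq d v | v <- enum T] | x != 0] ->
  graphic s <-> exists e : rel T, realizes e d.
Proof.
rewrite filter_map => /(perm_iotaP 0)[r rperm sE].
set t := [seq v <- enum T | _] in rperm sE.
rewrite size_map in rperm.
have szs : size s = size t by rewrite sE size_map (perm_size rperm) size_iota.
have rs (k : 'I_(size s)) : nth 0 r k < size t.
  have : nth 0 r k \in iota 0 (size t).
    by rewrite -(perm_mem rperm) mem_nth // (perm_size rperm) size_iota -szs.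
  by rewrite mem_iota.
(* [r] matches positions of [s] with positions in [t], the list of vertices of nonzero degree; these
   vertices form the image of [f]. *)
pose f (k : 'I_(size s)) : T := tnth (in_tuple t) (Ordinal (rs k)).
have szr : size r = size t by rewrite (perm_size rperm) size_iota.
have fE x0 k : f k = nth x0 t (nth 0 r k) by rewrite /f (tnth_nth x0).
have tuniq : uniq t by rewrite filter_uniq ?enum_uniq.
have runiq : uniq r by rewrite (perm_uniq rperm) iota_uniq.
have sE_nth x0 k : k < size r -> nth 0 r k < size t ->
    nth 0 s k = d (nth x0 t (nth 0 r k)).
  by move=> kr rk; rewrite sE (nth_map 0) // (nth_map x0).
have sk (k : 'I_(size s)) : nth 0 s k = d (f k).
  by rewrite (fE (f k)); apply: sE_nth; rewrite // szr -szs.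
rewrite graphicP -(@realizes_codom _ _ f).
- by split=> [] [e [esym eirr edeg]]; exists e; split=> // k;
    rewrite edeg /= sk.
- move=> k l; rewrite (fE (f k) k) (fE (f k) l) => /eqP.
  rewrite nth_uniq ?rs // nth_uniq ?szr -?szs // => /eqP; exact: val_inj.
- move=> v; transitivity (v \in t); last by rewrite mem_filter mem_enum andbT.
  apply/codomP/idP => [[k ->]|vt]; first exact: mem_tnth.
  have : index v t \in r by rewrite (perm_mem rperm) mem_iota index_mem.
  move=> ir; have lt : index (index v t) r < size s.
    by rewrite szs -szr index_mem.
  by exists (Ordinal lt); rewrite (fE v) /= nth_index // nth_index.
Qed.

(** * Forcing or avoiding the edge [ab] when degrees are nonincreasing *)

Section LabelledVertices.
Variables (n : nat) (d : 'I_n -> nat).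
Hypothesis dmono : forall v w : 'I_n, v <= w -> d w <= d v.
(* [t] stands for the index tilde d_i: [card_t] says that exactly [d a] vertices
   other than [a] come no later than [t]. *)
Variables a b t : 'I_n.
Hypotheses (nab : a != b) (da0 : 0 < d a) (card_t : d a = t.+1 - (a <= t)).

Let top := [set v : 'I_n | v <= t] :\ a.

Lemma card_top : #|top| = d a.
Proof.
rewrite card_t.
have <- : #|[set v : 'I_n | v <= t]| = t.+1.
  have winj : injective (widen_ord (ltn_ord t)) by move=> v w [] /val_inj.
  rewrite -[RHS]card_ord -cardsT -(card_imset _ winj); apply: eq_card => v.
  rewrite inE; apply/idP/imsetP => [vt|[w _ ->]]; last exact: (valP w).
  by exists (Ordinal (vt : v < t.+1)); last exact: val_inj.
by rewrite (cardsD1 a [set v : 'I_n | v <= t]) inE addKn.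
Qed.

Lemma realizes_with_edge : 0 < d b -> a != t ->
  d t <= d b \/ (forall v, d v <= d a) ->
  (exists e, realizes e d) -> exists e, realizes e d /\ e a b.
Proof.
move=> db0 neq_at db [e er]; have [esym eirr edeg] := er.
have [eab|neab] := boolP (e a b); first by exists e.
case: db => [dtb|damax].
  (* If [t] is not a neighbour of [a], the [d a] neighbours of [a] do not fit into [top] without
     [t], so one of them comes after [t]. *)
  have [k eak dkb] : exists2 k, e a k & d k <= d b.
    have [eat|neat] := boolP (e a t); first by exists t.
    have /subsetPn[k] : ~~ ([set w | e a w] \subset top :\ t).
      apply: contraL (leqnn (d a)) => /subset_leq_card.
      rewrite -[#|[set w | e a w]|]/(degree e a) edeg -{2}card_top -ltnNge.
      by rewrite (cardsD1 t top) !inE leqnn eq_sym neq_at add1n.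
    rewrite !inE => eak; rewrite !negb_and !negbK => /or3P[/eqP kt|/eqP ka|].
    - by rewrite kt (negbTE neat) in eak.
    - by rewrite ka eirr in eak.
    - rewrite -ltnNge => tk; exists k => //.
      by apply: leq_trans dtb; apply/dmono/ltnW.
  by have [e' [e'r _ e'ab]] := switch er eak neab nab dkb; exists e'.
have /card_gt0P[k] : 0 < degree e b by rewrite edeg.
rewrite inE => ebk.
have neba : ~~ e b a by rewrite esym.
have nba : b != a by rewrite eq_sym.
have [e' [e'r _ e'ba]] := switch er ebk neba nba (damax k).
by exists e'; split=> //; case: e'r => e'sym _ _; rewrite e'sym.
Qed.

Lemma realizes_without_edge (d' := fun v => d v - (v == a) - (v == b)) :
  d b <= (d t).+1 ->
  (exists e, realizes e d') -> exists e, realizes e d' /\ ~~ e a b.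
Proof.
move=> dbt [e er]; have [esym eirr edeg] := er.
have [eab|neab] := boolP (e a b); last by exists e.
(* Here [a] has only [d a - 1] neighbours, too few to fill [top]. *)
have /subsetPn[k] : ~~ (top \subset [set w | e a w]).
  apply: contraL (leqnn (d a)) => /subset_leq_card.
  rewrite -[#|[set w | e a w]|]/(degree e a) edeg card_top /d'.
  by rewrite eqxx (negbTE nab); lia.
rewrite !inE => /andP[nka kt] neak.
have nkb : k != b by apply: contraNneq neak => ->.
have nak : a != k by rewrite eq_sym.
(* [d' b = d b - 1 <= d t <= d k = d' k], as [k] comes no later than [t]. *)
have d'bk : d' b <= d' k.
  rewrite /d' (negbTE nka) (negbTE nkb) eqxx eq_sym (negbTE nab).
  by have := dmono kt; lia.
by have [e' [e'r ne'ab _]] := switch er eab neak nak d'bk; exists e'.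
Qed.

End LabelledVertices.

Theorem lemma3p1 (n : nat) (D : seq nat) (hn : size D = n)
  (hsorted : sorted geq D)
  (hpos : forall k : nat, 1 <= k <= n -> 0 < term D k)
  (hd1 : term D 1 < n)
  (i : nat) (hi : 1 <= i <= n)
  (j : nat) (hj : 1 <= j <= n) (hij : j <> i)
  (hcond : [\/ term D j = term D (tilde D i),
               term D j = term D (tilde D i) + 1
             | (forall k : nat, 1 <= k <= n -> term D k <= term D i)
               /\ term D i + 1 < j]) :
  graphic D <-> graphic (two_reduction D i j).
Proof.
subst n; rewrite /term in hpos hd1 hcond.
have geq_tr : transitive geq by move=> y x z /= xy yz; apply: leq_trans xy.
have mono k l : k <= l -> l < size D -> nth 0 D l <= nth 0 D k.
  move=> kl lD; apply: (sorted_leq_nth geq_tr leqnn 0 hsorted) => //.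
  exact: leq_ltn_trans lD.
have pos k : k < size D -> 0 < nth 0 D k by move=> kD; apply: (hpos k.+1).
have iD : i.-1 < size D by lia.
have jD : j.-1 < size D by lia.
have di := leq_ltn_trans (mono 0 i.-1 (leq0n _) iD) hd1.
have di0 := pos _ iD.
(* The index [tilde D i] does not exceed the length, since [d_i <= d_1 < n]. *)
have tD : (tilde D i).-1 < size D.
  by rewrite /tilde /term; case: (ltnP _ i); lia.
pose d (v : 'I_(size D)) := nth 0 D v.
pose a := Ordinal iD; pose b := Ordinal jD; pose t := Ordinal tD.
have nab : a != b by rewrite -val_eqE /=; lia.
have neq_at : a != t.
  by rewrite -val_eqE /= /tilde /term; case: (ltnP _ i) => ?; lia.
(* If [d_i < i], then [t] precedes [a] and [t.+1 = d_i]; otherwise [a] precedes [t] and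
   [t.+1 = d_i + 1]. *)
have card_t : d a = t.+1 - (a <= t).
  by rewrite /d /= /tilde /term; case: (ltnP _ i) => ?; lia.
have dmono (v w : 'I_(size D)) : v <= w -> d w <= d v.
  by move=> vw; apply: mono.
have redE : graphic (two_reduction D i j) <->
    exists e, realizes e (fun v => d v - (v == a) - (v == b)).
  apply: graphic_nonzero_terms; apply: perm_filter; rewrite perm_sort.
  rewrite (iotaDl 1 0) -val_enum_ord -!map_comp.
  rewrite (@eq_map _ _ _ (fun v => d v - (v == a) - (v == b))) // => v /=.
  rewrite /term /= add1n -!val_eqE /=.
  by congr (_ - _ - _); congr (nat_of_bool _); lia.
rewrite redE graphicP; split.
- move=> Dreal; have [|e [er eab]] :=
    realizes_with_edge dmono nab card_t (pos _ jD) neq_at _ Dreal.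
    case: hcond => [tj|tj|[dimax _]]; [by left; rewrite /d /= tj| |].
      by left; rewrite /d /= tj leq_addr.
    by right=> v; apply: (dimax v.+1); rewrite /= ltn_ord.
  by exists (flip_edge e a b); apply: realizes_del_edge.
- move=> redreal; have [|e [er neab]] :=
    realizes_without_edge dmono nab di0 card_t _ redreal.
    rewrite /d /=; case: hcond => [->|->|[_ lt_j]]; rewrite ?addn1 //.
    (* In case (3), [tilde D i <= d_i + 1 < j], so [d_j] is at most the term at [tilde D i]. *)
    by apply/leqW/mono => //; rewrite /tilde /term; case: (ltnP _ i); lia.
  exists (flip_edge e a b).
  by apply: realizes_add_edge er neab => //; apply: pos.
Qed.
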